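(* Let $1\le k\le n$, let $\mathcal S\subset\mathcal P_n$ be the stabilizer group of a stabilizer code with logical Pauli group $\mathcal L$, and let $\tilde G\subset\tilde{\mathcal P}_n$ be a nontrivial subgroup. Let $p\in[0,1)$, $z=p/(3-3p)$, $p_{\rm DD}\in[0,1]$, and write $W(A)=W(A;z)$. In the LDD-only strategy of the error-detection setting (no postselection) one has $P_{A,{\rm LDD}}=1$ and $$1-F_{\rm LDD}=\frac{W(U\setminus T)+p_{\rm DD}W(V\setminus T)-4^{-k}\bigl(W(U\setminus N)+p_{\rm DD}W(V\setminus N)\bigr)}{W(U)+p_{\rm DD}W(V)}.$$
   Context: Paulis. $\mathcal P_n$ is the $n$-qubit Pauli group (with phases $\pm1,\pm i$), $\tilde{\mathcal P}_n=\mathcal P_n/\langle iI\rangle$, and $\pi:\mathcal P_n\to\tilde{\mathcal P}_n$ is the projection. Elements of $\tilde{\mathcal P}_n$ are represented by strings in $\{I,X,Y,Z\}^n$; $\mathrm{wt}(E')$ is the number of non-identity letters. Two elements of $\tilde{\mathcal P}_n$ are said to commute (anticommute) if their representatives in $\mathcal P_n$ do. Code. $\mathcal S\subset\mathcal P_n$ is a subgroup with $2^{n-k}$ elements not containing $-I$. $C(\mathcal S)$ is its centralizer in $\mathcal P_n$. $\mathcal L\subseteq C(\mathcal S)$ is a subgroup with $C(\mathcal S)=\mathcal S\mathcal L$ and $\pi(\mathcal S)\cap\pi(\mathcal L)=\{\pi(I)\}$. Sets. $T=\pi(\mathcal S)$; $N=\pi(\mathcal S\mathcal L)=\pi(C(\mathcal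 S))$ (undetected errors; errors outside $N$ are detected); $U=\tilde G^\perp=\{E'\in\tilde{\mathcal P}_n: E'\text{ commutes with every element of }\tilde G\}$ (unsuppressed errors); $V=\tilde{\mathcal P}_n\setminus U$ (suppressed errors). For $A\subset\tilde{\mathcal P}_n$, $W(A;z)=\sum_{E'\in A}z^{\mathrm{wt}(E')}$. LDD-only strategy (detection setting). A random error $E'\in\tilde{\mathcal P}_n$ is drawn from the distribution obtained from $(1-p)^{n-\mathrm{wt}(E')}(p/3)^{\mathrm{wt}(E')}$ by multiplying the probabilities of all $E'\in V$ by $p_{\rm DD}$ and renormalizing. Every run is accepted. If $E'\in N$, the induced logical Pauli class is the class of $E'$ in $N/T$. If $E'\notin N$, the output is replaced by the maximally mixed codespace state, i.e. the logical class is uniformly random among the $4^k$ elements of $N/T$. $P_{A,\rm LDD}$ is the acceptance probability and $F_{\rm LDD}$ is the probability that the logical class is trivial. *)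

(* Defs.v *)
From HB Require Import structures.
From mathcomp Require Import all_boot all_order all_fingroup all_algebra.

Set Implicit Arguments.
Unset Strict Implicit.
Unset Printing Implicit Defensive.

Import Order.TTheory GRing.Theory Num.Theory.
Local Open Scope ring_scope.

Inductive letter := PI | PX | PY | PZ.

Definition letter_code (a : letter) : bool * bool :=
  match a with
  | PI => (false, false) | PX => (true, false)
  | PY => (true, true) | PZ => (false, true)
  end.
Definition letter_decode (c : bool * bool) : letter :=
  match c with
  | (false, false) => PI | (true, false) => PX
  | (true, true) => PY | (false, true) => PZ
  end.
Lemma letter_codeK : cancel letter_code letter_decode. Proof. by case. Qed.
HB.instance Definition _ := Finite.copy letter (can_type letter_codeK).

(* The product of the letters a and b is i ^ (letter_phase a b) times the
   letter (letter_mul a b): XY = iZ, YX = -iZ, and cyclically. *)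
Definition letter_mul (a b : letter) : letter :=
  match a, b with
  | PI, c | c, PI => c
  | PX, PX | PY, PY | PZ, PZ => PI
  | PX, PY | PY, PX => PZ
  | PY, PZ | PZ, PY => PX
  | PZ, PX | PX, PZ => PY
  end.
Definition letter_phase (a b : letter) : 'Z_4 :=
  match a, b with
  | PX, PY | PY, PZ | PZ, PX => 1
  | PY, PX | PZ, PY | PX, PZ => 3
  | _, _ => 0
  end.

(* Check of the two tables above against the Pauli matrices. *)
Definition letter_mx (C : numClosedFieldType) (a : letter) : 'M[C]_2 :=
  \matrix_(i < 2, j < 2)
    match a with
    | PI => (i == j)%:R
    | PX => (i != j)%:R
    | PY => if i == j then 0 else if i == 0 then - 'i else 'i
    | PZ => if i != j then 0 else if i == 0 then 1 else - 1
    end.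
Lemma letter_mxM (C : numClosedFieldType) (a b : letter) :
  letter_mx C a *m letter_mx C b =
  'i ^+ letter_phase a b *: letter_mx C (letter_mul a b).
Proof.
have i3 : 'i ^+ 3 = - 'i :> C by rewrite exprS sqrCi mulrN1.
apply/matrixP=> i j; rewrite !mxE big_ord_recl big_ord1 !mxE.
case: i => [[|[|i]] // Hi]; case: j => [[|[|j]] // Hj]; case: a; case: b => //=;
rewrite ?(mulr0, mul0r, mulr1, mul1r, addr0, add0r, mulrN, mulNr, expr0, expr1,
          opprK, i3, oppr0) -?expr2 ?sqrCi ?opprK ?scale1r //.
Qed.

(* Pauli a f stands for i ^ a times the tensor product of the letters f j. *)
Record pauli (n : nat) :=
  Pauli { phase : 'Z_4; letters : {ffun 'I_n -> letter} }.

Definition pauli_code n (x : pauli n) := (phase x, letters x).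
Definition pauli_decode n (c : 'Z_4 * {ffun 'I_n -> letter}) :=
  Pauli c.1 c.2.
Lemma pauli_codeK n : cancel (@pauli_code n) (@pauli_decode n).
Proof. by case. Qed.
HB.instance Definition _ n := Finite.copy (pauli n) (can_type (@pauli_codeK n)).

Definition pauli_mul n (x y : pauli n) : pauli n :=
  Pauli (phase x + phase y + \sum_j letter_phase (letters x j) (letters y j))
        [ffun j => letter_mul (letters x j) (letters y j)].
Definition pauli_one n : pauli n := Pauli 0 [ffun => PI].
Definition pauli_inv n (x : pauli n) : pauli n := Pauli (- phase x) (letters x).

Lemma letter_mulA : associative letter_mul. Proof. by do 3 case. Qed.
Lemma letter_phaseA a b c :
  letter_phase a b + letter_phase (letter_mul a b) c =
  letter_phase b c + letter_phase a (letter_mul b c).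
Proof. by apply: val_inj; case: a; case: b; case: c. Qed.

Lemma pauli_mulA n : associative (@pauli_mul n).
Proof.
case=> a f [b g] [c h]; congr Pauli => /=; last first.
  by apply/ffunP=> j; rewrite !ffunE letter_mulA.
rewrite -!addrA; congr (_ + (_ + _)); rewrite [in RHS]addrCA; congr (_ + _).
rewrite -!big_split /=; apply: eq_bigr => j _.
by rewrite !ffunE letter_phaseA.
Qed.
Lemma pauli_mul1 n : left_id (pauli_one n) (@pauli_mul n).
Proof.
case=> a f; congr Pauli => /=; last by apply/ffunP=> j; rewrite !ffunE.
by rewrite add0r big1 ?addr0 // => j _; rewrite ffunE.
Qed.
Lemma pauli_mulV n : left_inverse (pauli_one n) (@pauli_inv n) (@pauli_mul n).
Proof.
case=> a f; congr Pauli => /=; last first.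
  by apply/ffunP=> j; rewrite !ffunE; case: (f j).
by rewrite addNr add0r big1 // => j _; case: (f j).
Qed.
HB.instance Definition _ n := Finite_isGroup.Build (pauli n)
  (@pauli_mulA n) (@pauli_mul1 n) (@pauli_mulV n).

Definition iId n : pauli n := Pauli 1 [ffun => PI].
Definition negId n : pauli n := Pauli 2 [ffun => PI].

(* <[iId n]> is central, so its normaliser is the whole group: ptilde n is the
   full quotient group and A / <[iId n]> is the full image of A. *)
Notation ptilde n := (coset_of <[iId n]>%g).
Notation ppi n := (coset <[iId n]>%g).

Lemma iId_central n (x : pauli n) : commute (iId n) x.
Proof.
case: x => a f; congr Pauli => /=; last first.
  by apply/ffunP=> j; rewrite !ffunE; case: (f j).
congr (_ + _); first by rewrite addrC.
by apply: eq_bigr => j _; rewrite ffunE; case: (f j).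
Qed.

Lemma iId_norm n (x : pauli n) : x \in 'N(<[iId n]>)%g.
Proof.
apply: (subsetP (cent_sub _)); rewrite cent_cycle.
by apply/cent1P; apply: commute_sym; exact: iId_central.
Qed.

Lemma repr_ppi n (x : pauli n) : exists m, repr (ppi n x) = (iId n ^+ m * x)%g.
Proof.
have: repr (ppi n x) \in ppi n x by apply: mem_repr_coset.
rewrite val_coset ?iId_norm //.
by case/rcosetP=> y /cycleP[m ->] ->; exists m.
Qed.

Definition pcommute n (E F : ptilde n) : bool :=
  (repr E * repr F == repr F * repr E)%g.

Lemma pcommute_ppi n (x y : pauli n) :
  pcommute (ppi n x) (ppi n y) = (x * y == y * x)%g.
Proof.
rewrite /pcommute; have [a ->] := repr_ppi x; have [b ->] := repr_ppi y.
have C c z : commute (iId n ^+ c)%g z.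
  by apply: commute_sym; apply: commuteX; apply: commute_sym; apply: iId_central.
have M c d (u v : pauli n) :
    (iId n ^+ c * u * (iId n ^+ d * v) = iId n ^+ (c + d) * (u * v))%g.
  by rewrite expgD -!mulgA; congr (_ * _)%g; rewrite mulgA -C -mulgA.
by rewrite !M addnC (inj_eq (mulgI _)).
Qed.

Definition wt n (E : ptilde n) : nat := #|[set j | letters (repr E) j != PI]|.

Lemma wt_ppi n (x : pauli n) : wt (ppi n x) = #|[set j | letters x j != PI]|.
Proof.
rewrite /wt; have [a ->] := repr_ppi x; congr #|pred_of_set _|.
elim: a => [|a IHa]; first by rewrite expg0 mul1g.
rewrite -IHa expgS -mulgA; apply/setP=> j; rewrite !inE.
by rewrite [in LHS]/monoid.mul /= !ffunE; case: (letters _ j).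
Qed.

Definition unsuppressed n (G : {set ptilde n}) : {set ptilde n} :=
  [set E | [forall F in G, pcommute E F]].
Definition suppressed n (G : {set ptilde n}) : {set ptilde n} :=
  ~: unsuppressed G.

Definition W (R : realFieldType) n (A : {set ptilde n}) (z : R) : R :=
  \sum_(E in A) z ^+ wt E.

Definition err_weight (R : realFieldType) n (V : {set ptilde n}) (p pDD : R)
    (E : ptilde n) : R :=
  (1 - p) ^+ (n - wt E) * (p / 3%:R) ^+ wt E * (if E \in V then pDD else 1).
Definition err_prob (R : realFieldType) n (V : {set ptilde n}) (p pDD : R)
    (E : ptilde n) : R :=
  err_weight V p pDD E / \sum_F err_weight V p pDD F.

(* Conditional law, given the error E, of the outcome of a run: None means that
   the run is rejected (this never happens), Some c that it is accepted with
   logical Pauli class c in N / T. *)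
Definition LDD_outcome (R : realFieldType) n (T N : {set ptilde n})
    (E : ptilde n) (o : option (coset_of T)) : R :=
  match o with
  | None => 0
  | Some c =>
      if E \in N then (c == coset T E)%:R
      else if c \in (N / T)%g then #|(N / T)%g|%:R^-1 else 0
  end.

Definition LDD_law (R : realFieldType) n (T N V : {set ptilde n}) (p pDD : R)
    (o : option (coset_of T)) : R :=
  \sum_(E : ptilde n) err_prob V p pDD E * LDD_outcome R N E o.

Definition PA_LDD (R : realFieldType) n (T N V : {set ptilde n}) (p pDD : R) : R :=
  \sum_(o : option (coset_of T) | o != None) LDD_law N V p pDD o.
Definition F_LDD (R : realFieldType) n (T N V : {set ptilde n}) (p pDD : R) : R :=
  LDD_law N V p pDD (Some (1%g : coset_of T)).

(* Main.v *)
(** The commutation sign of two Paulis is a bicharacter. Summing it over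
    [P_n * S] in both orders gives [#|C(S)| * #|S| = 4 ^ (n + 1)], because only
    the identity of [S] is central; hence [N / T] has [4 ^ k] elements. Given an
    error [E], the logical class is then trivial with probability [1] on [T],
    [0] on [N \ T] and [4 ^- k] outside [N], that is,
    [1 - (E \notin T) + 4 ^- k * (E \notin N)], and one averages over [E]. *)
Require Import Defs.
From mathcomp Require Import all_boot all_order all_fingroup all_algebra.
From mathcomp Require Import ring.

Set Implicit Arguments.
Unset Strict Implicit.
Unset Printing Implicit Defensive.

Import Order.TTheory GRing.Theory Num.Theory.
Local Open Scope ring_scope.

(** * The commutation sign of two Paulis *)

Definition letter_anti (a b : letter) : bool := [&& a != PI, b != PI & a != b].

(** Each site with anticommuting letters contributes a sign, so only the parity of the number of
    such sites matters. *)
Definition pauli_anti n (x y : pauli n) : bool :=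
  \big[addb/false]_j letter_anti (letters x j) (letters y j).

Lemma letter_antiC a b : letter_anti a b = letter_anti b a.
Proof. by case: a; case: b. Qed.

Lemma letter_antiM a b c :
  letter_anti a (letter_mul b c) = letter_anti a b (+) letter_anti a c.
Proof. by case: a; case: b; case: c. Qed.

(** The phases are exponents of [i], so a sign is the exponent 2: anticommuting letters have phases
    1 and 3. *)
Lemma letter_phaseC a b :
  letter_phase a b = letter_phase b a + (letter_anti a b)%:R *+ 2.
Proof. by apply: val_inj; case: a; case: b. Qed.

Lemma pauli_antiC n (x y : pauli n) : pauli_anti x y = pauli_anti y x.
Proof. by apply: eq_bigr => j _; rewrite letter_antiC. Qed.

Lemma pauli_antiMr n (x y z : pauli n) :
  pauli_anti x (y * z)%g = pauli_anti x y (+) pauli_anti x z.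
Proof.
by rewrite /pauli_anti -big_split; apply: eq_bigr => j _; rewrite ffunE letter_antiM.
Qed.

Lemma pauli_antiMl n (x y z : pauli n) :
  pauli_anti (x * y)%g z = pauli_anti x z (+) pauli_anti y z.
Proof. by rewrite pauli_antiC pauli_antiMr !(pauli_antiC z). Qed.

Lemma letters_mulC n (x y : pauli n) : letters (x * y)%g = letters (y * x)%g.
Proof.
by apply/ffunP=> j; rewrite !ffunE; case: (letters x j); case: (letters y j).
Qed.

Lemma phase_mulC n (x y : pauli n) :
  phase (x * y)%g = phase (y * x)%g + (pauli_anti x y)%:R *+ 2.
Proof.
rewrite [LHS]/= [phase (y * x)%g]/= [phase y + _]addrC -[RHS]addrA; congr (_ + _).
rewrite /pauli_anti; elim: (index_enum _) => [|j s IHs].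
  by rewrite !big_nil mul0rn addr0.
have addb2 (a b : bool) : a%:R *+ 2 + b%:R *+ 2 = (a (+) b)%:R *+ 2 :> 'Z_4.
  by apply: val_inj; case: a; case: b.
by rewrite !big_cons IHs letter_phaseC addrACA addb2.
Qed.

Lemma commute_anti n (x y : pauli n) :
  (x * y == y * x)%g = ~~ pauli_anti x y.
Proof.
have := phase_mulC x y; have := letters_mulC x y.
case: (x * y)%g (y * x)%g => [a f] [b g] /= -> ->.
case: pauli_anti; last by rewrite mulr0n mul0rn addr0 eqxx.
(* Equal phases would give 2 = 0 in ['Z_4]. *)
apply/eqP => -[] /eqP; rewrite -subr_eq0 addrAC subrr add0r.
by [].
Qed.

Lemma negId_anti n (x y : pauli n) :
  (x * y)%g = (negId n ^+ pauli_anti x y * (y * x))%g.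
Proof.
have := phase_mulC x y; have := letters_mulC x y.
case: (x * y)%g (y * x)%g => [a f] [b g] /= -> ->.
case: pauli_anti; last by rewrite mulr0n mul0rn addr0 expg0 mul1g.
rewrite expg1; congr Pauli => /=; last by apply/ffunP => j; rewrite !ffunE.
rewrite big1 ?addr0 => [|j _]; last by rewrite ffunE.
by rewrite addrC.
Qed.

(** * Phases, order and centre of the Pauli group *)

Lemma iId_expE n m : (iId n ^+ m)%g = Pauli m%:R [ffun => PI].
Proof.
elim: m => [|m IHm]; first by rewrite expg0.
rewrite expgS IHm; congr Pauli => /=; last by apply/ffunP => j; rewrite !ffunE.
by rewrite big1 ?addr0 ?mulrS // => j _; rewrite !ffunE.
Qed.

Lemma cycle_iIdE n : <[iId n]>%g = [set Pauli a [ffun => PI] | a : 'Z_4].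
Proof.
apply/setP => x; apply/cycleP/imsetP => [[m ->] | [a _ ->]].
  by exists m%:R; rewrite ?iId_expE.
by exists a; rewrite iId_expE natr_Zp.
Qed.

Lemma card_cycle_iId n : #|<[iId n]>%g| = 4%N.
Proof. by rewrite cycle_iIdE card_imset ?card_ord // => a b []. Qed.

Lemma mem_cycle_iId n (x : pauli n) :
  (x \in <[iId n]>%g) = (letters x == [ffun => PI]).
Proof.
rewrite cycle_iIdE; apply/imsetP/eqP => [[a _ ->] //|].
by case: x => a f /= ->; exists a.
Qed.

Lemma card_letter : #|{: letter}| = 4%N.
Proof.
rewrite -[4%N]/((2 * 2)%N) -card_bool -card_prod.
apply: (bij_eq_card (f := letter_code)); exists letter_decode; first exact: letter_codeK.
by case=> [[] []].
Qed.

Lemma card_pauli n : #|{: pauli n}| = (4 ^ n.+1)%N.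
Proof.
transitivity #|{: 'Z_4 * {ffun 'I_n -> letter}}|; last first.
  by rewrite card_prod card_ffun card_letter !card_ord expnS.
by apply: (bij_eq_card (f := @pauli_code n)); exists (@pauli_decode n); case.
Qed.

Definition one_letter n (j : 'I_n) (a : letter) : pauli n :=
  Pauli 0 [ffun i => if i == j then a else PI].

Lemma one_letter_anti n (j : 'I_n) a (x : pauli n) :
  pauli_anti (one_letter j a) x = letter_anti a (letters x j).
Proof.
rewrite /pauli_anti (bigD1 j) //= ffunE eqxx big1 ?addbF // => i /negPf ij.
by rewrite ffunE ij.
Qed.

(** Testing against a single X and a single Z at site [j] suffices: only the identity letter
    commutes with both. *)
Lemma pauli_center n (x : pauli n) :
  (forall y, ~~ pauli_anti y x) -> x \in <[iId n]>%g.
Proof.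
move=> H; rewrite mem_cycle_iId; apply/eqP/ffunP => j; rewrite ffunE.
move: (H (one_letter j PX)) (H (one_letter j PZ)).
by rewrite !one_letter_anti; case: (letters x j).
Qed.

(** * Sign characters and the order of the centralizer *)

Lemma sum_sign_char {gT : finGroupType} (H : {group gT}) (a : gT -> bool) :
    (forall x y, x \in H -> y \in H -> a (x * y)%g = a x (+) a y) ->
  \sum_(x in H) (-1) ^+ a x =
    (if [forall x in H, ~~ a x] then #|H|%:R else 0) :> int.
Proof.
move=> aM; case: ifPn => [/forall_inP a0 | /forall_inPn[t Ht]].
  by rewrite (eq_bigr (fun => 1)) => [|x /a0/negPf->]; rewrite ?sumr_const.
rewrite negbK => at1; set s := \sum_(_ in _) _.
(* Translation by [t] permutes [H] and flips every sign; integers have no 2-torsion, so the sum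
   vanishes. *)
have: s = - s.
  rewrite {1}/s (reindex_inj (mulgI t)) /= -sumrN.
  apply: eq_big => [x|x Hx]; first by rewrite groupMl.
  rewrite groupMl // in Hx.
  by rewrite aM // at1 -signrN.
by move/eqP; rewrite -addr_eq0 -mulr2n mulrn_eq0 => /eqP.
Qed.

(** The commutator of an anticommuting pair would be [negId n]. *)
Lemma stabilizer_abelian n (S : {group pauli n}) :
  negId n \notin S -> abelian S.
Proof.
move=> S_negI.
apply/centsP => x Sx y Sy; apply/eqP; rewrite commute_anti; apply: contra S_negI => anti.
have -> : negId n = (x * y * (y * x)^-1)%g by rewrite (negId_anti x y) anti expg1 mulgK.
by rewrite !(groupM, groupV).
Qed.

(** The phases [i] and [-i] square to [-1], so any nontrivial phase in [S] would put [negId n] in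
    [S]. *)
Lemma stabilizer_cycle_iId n (S : {group pauli n}) :
  negId n \notin S -> S :&: <[iId n]>%g = 1%g.
Proof.
move=> S_negI.
apply/trivgP/subsetP => x /setIP[Sx]; rewrite /= cycle_iIdE => /imsetP[a _ xE].
have Sxx : (x * x)%g \in S by rewrite groupM.
have xxE : (x * x)%g = Pauli (a + a) [ffun => PI].
  rewrite xE; congr Pauli => /=; last by apply/ffunP => j; rewrite !ffunE.
  by rewrite big1 ?addr0 // => j _; rewrite ffunE.
have nS b : Pauli b [ffun => PI] \in S -> b != 2.
  by move=> Sb; apply: contraNneq S_negI => b2; rewrite /negId -b2.
move: (nS (a + a)); rewrite -xxE => /(_ Sxx).
move: (nS a); rewrite -xE => /(_ Sx).
rewrite inE xE; case: a {xE xxE} => [[|[|[|[|m]]]] Hm] //= _ _.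
by apply/eqP; congr Pauli; apply: val_inj.
Qed.

Lemma card_centralizer n (S : {group pauli n}) :
  negId n \notin S -> (#|'C(S)%g| * #|S|)%N = (4 ^ n.+1)%N.
Proof.
move=> S_negI.
apply/eqP; rewrite -(eqr_nat int) -card_pauli; apply/eqP.
(* With [x] fixed, the sum over [S] is [#|S|] if [x] centralizes [S] and 0 otherwise. *)
transitivity (\sum_(x : pauli n) \sum_(s in S) (-1) ^+ pauli_anti x s : int).
  transitivity (\sum_(x : pauli n) if x \in 'C(S)%g then #|S|%:R else 0 : int).
    by rewrite -big_mkcond sumr_const natrM mulr_natl.
  apply: eq_bigr => x _; rewrite sum_sign_char => [|s t _ _]; last exact: pauli_antiMr.
  congr (if _ then _ else _); apply/centP/forall_inP => xS s Ss.
    by rewrite -commute_anti; apply/eqP/xS.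
  by apply/eqP; rewrite commute_anti xS.
(* In the other order, [s = 1] alone contributes, and gives the order of the whole Pauli group. *)
rewrite exchange_big (bigD1 1%g) //= [X in _ + X]big1 ?addr0 => [|s /andP[Ss s1]].
  rewrite (eq_bigr (fun => 1)) ?sumr_const // => x _.
  by have := commute_anti x 1%g; rewrite mulg1 mul1g eqxx => /esym/negPf->.
transitivity (\sum_(x in [set: pauli n]%G) (-1) ^+ pauli_anti x s : int).
  by apply: eq_bigl => x; rewrite inE.
rewrite sum_sign_char => [|x y _ _]; last exact: pauli_antiMl.
case: ifP => // /forall_inP anti.
case/negP: s1; rewrite -in_set1 -set1gE -(stabilizer_cycle_iId S_negI) inE Ss.
by apply: pauli_center => y; apply: anti; rewrite inE.
Qed.

(** * The quotient by phases and the number of logical classes *)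

Lemma cycle_iId_norms n (H : {set pauli n}) : H \subset 'N(<[iId n]>)%g.
Proof. by apply/subsetP => x _; apply: iId_norm. Qed.

(** Letter multiplication is commutative, so a commutator is a pure phase. *)
Lemma ptilde_abelian n : abelian [set: ptilde n].
Proof.
apply/centsP => E _ F _.
case: (cosetP E) => x Nx ->; case: (cosetP F) => y Ny ->.
apply/commgP; rewrite -morphR //.
apply/eqP/coset_id; rewrite mem_cycle_iId.
rewrite /commg /conjg; apply/eqP/ffunP => j; rewrite !ffunE.
by case: (letters x j); case: (letters y j).
Qed.

Lemma ptilde_norms n (A B : {set ptilde n}) : A \subset 'N(B)%g.
Proof.
apply: subset_trans (subsetT A) _.
apply: subset_trans (cent_sub B).
by apply: subset_trans (ptilde_abelian n) _; rewrite centS ?subsetT.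
Qed.

(** Dividing by phases is injective on [S] but divides the order of ['C(S)] by 4, since ['C(S)]
    contains all phases. The rest is Lagrange and the order of the centralizer. *)
Lemma card_logical_classes n k (S : {group pauli n}) :
    (k <= n)%N -> #|S| = (2 ^ (n - k))%N -> negId n \notin S ->
  #|(('C(S) / <[iId n]>) / (S / <[iId n]>))%g| = (4 ^ k)%N.
Proof.
move=> kn cS SnegI; have sSC : S \subset 'C(S)%g by exact: stabilizer_abelian.
rewrite card_quotient ?ptilde_norms //.
have cT : #|(S / <[iId n]>)%g| = (2 ^ (n - k))%N.
  rewrite -cS; apply/esym/card_isog/quotient_isog; first exact: cycle_iId_norms.
  by rewrite setIC stabilizer_cycle_iId.
have sZC : <[iId n]>%g \subset 'C(S)%g.
  rewrite cycle_subG; apply/centP => x _; exact: iId_central.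
have cN : (#|('C(S) / <[iId n]>)%g| * 4)%N = #|'C(S)%g|.
  by rewrite card_quotient ?cycle_iId_norms // -(card_cycle_iId n) mulnC Lagrange.
have := card_centralizer SnegI; rewrite -cN -(Lagrange (quotientS _ sSC)) cT cS.
set q := #|_ : _|%g; set m := (n - k)%N.
have -> : (4 ^ n.+1 = 2 ^ m * 2 ^ m * 4 * 4 ^ k)%N.
  by rewrite -expnMn -expnSr -expnD addSn subnK.
move=> E; apply/eqP; rewrite -(@eqn_pmul2l (2 ^ m * 2 ^ m * 4)) ?muln_gt0 ?expn_gt0 //.
by rewrite -E; apply/eqP; ring.
Qed.

(** * The error distribution and the law of the outcome *)

Lemma wt_le n (E : ptilde n) : (wt E <= n)%N.
Proof. by rewrite -[leqRHS](card_ord n) max_card. Qed.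

Lemma wt1 n : wt (1%g : ptilde n) = 0%N.
Proof.
rewrite -(morph1 (coset_morphism <[iId n]>%g)) /= wt_ppi.
by apply: eq_card0 => j; rewrite !inE ffunE eqxx.
Qed.

Section Detection.
Variables (R : realFieldType) (n : nat).
Implicit Types (p pDD z : R) (U A : {set ptilde n}).

(** The error weight without the common factor [(1 - p) ^+ n], which cancels on normalization. *)
Definition tilt U pDD z (E : ptilde n) : R :=
  z ^+ wt E * (if E \in ~: U then pDD else 1).

Lemma sum_tilt U A pDD z :
  \sum_(E in ~: A) tilt U pDD z E = W (U :\: A) z + pDD * W (~: U :\: A) z.
Proof.
rewrite (bigID (mem U)) /=; congr (_ + _); last rewrite mulr_sumr.
  apply: eq_big => [E | E /andP[_ EU]]; first by rewrite !inE.
  by rewrite /tilt inE EU mulr1.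
apply: eq_big => [E | E /andP[_ EU]]; first by rewrite !inE.
by rewrite /tilt inE EU mulrC.
Qed.

Lemma sum_tiltT U pDD z : \sum_E tilt U pDD z E = W U z + pDD * W (~: U) z.
Proof.
have := sum_tilt U set0 pDD z; rewrite !setD0 => <-.
by apply: eq_bigl => E; rewrite !inE.
Qed.

Lemma W_ge0 A z : 0 <= z -> 0 <= W A z.
Proof. by move=> z0; apply: sumr_ge0 => E _; rewrite exprn_ge0. Qed.

(** The identity has weight 0 and is never suppressed, so it contributes [z ^+ 0 = 1] even if [z] or
    [pDD] vanishes. *)
Lemma sum_tilt_gt0 U pDD z :
  1%g \in U -> 0 <= z -> 0 <= pDD -> 0 < W U z + pDD * W (~: U) z.
Proof.
move=> U1 z0 d0; rewrite ltr_pwDl ?mulr_ge0 ?W_ge0 //.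
rewrite /W (bigD1 1%g) //= wt1 expr0 ltr_pwDl ?ltr01 //.
by apply: sumr_ge0 => E _; rewrite exprn_ge0.
Qed.

Lemma err_probE U p pDD E :
  p < 1 ->
  err_prob (~: U) p pDD E =
    tilt U pDD (p / (3%:R - 3%:R * p)) E
    / \sum_F tilt U pDD (p / (3%:R - 3%:R * p)) F.
Proof.
move=> p1; have q0 : 1 - p != 0 by rewrite subr_eq0 gt_eqF.
have wE F : err_weight (~: U) p pDD F =
    (1 - p) ^+ n * tilt U pDD (p / (3%:R - 3%:R * p)) F.
  rewrite /err_weight /tilt mulrA; congr (_ * _).
  (* This is where [z] comes from; as [wt E <= n], the powers of [1 - p] then recombine to exactly
     [n]. *)
  have -> : p / 3%:R = (1 - p) * (p / (3%:R - 3%:R * p)).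
    by field; rewrite -{1}[3]mulr1 -mulrBr mulf_neq0 // pnatr_eq0.
  by rewrite exprMn mulrA -exprD subnK ?wt_le.
rewrite /err_prob wE (eq_bigr _ (fun F _ => wE F)) -mulr_sumr.
by rewrite -mulf_div divff ?mul1r ?expf_neq0.
Qed.

Variables (T N : {group ptilde n}).

(** The accepted classes carry a point mass at the class of [E] inside [N], and the uniform law on
    [N / T] outside. *)
Lemma sum_LDD_outcome (E : ptilde n) :
  \sum_(o : option (coset_of T) | o != None) LDD_outcome R N E o = 1.
Proof.
rewrite (reindex_omap Some id) => [|[]//] /=; case: (E \in N).
  rewrite (bigD1 (coset T E)) ?eqxx //= big1 ?addr0 // => c /andP[_ /negPf->] //.
rewrite (eq_bigl predT) => [|c]; last by rewrite /= eqxx.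
rewrite -big_mkcond sumr_const -[_^-1 *+ _]mulr_natl mulfV //.
by rewrite pnatr_eq0 -lt0n cardG_gt0.
Qed.

Lemma LDD_outcome1 (E : ptilde n) :
  T \subset N ->
  LDD_outcome R N E (Some (1%g : coset_of T)) =
    1 - (E \notin T)%:R + #|(N / T)%g|%:R^-1 * (E \notin N)%:R.
Proof.
move=> sTN; rewrite /= group1; case: ifPn => [EN | /negPf EN].
  rewrite mulr0 addr0.
  (* [coset T] takes the default value 1 off the normalizer of [T]; commutativity of the quotient
     rules this case out. *)
  have NE : E \in 'N(T)%g by apply: (subsetP (ptilde_norms [set E] T)); rewrite inE.
  have -> : (1%g == coset T E) = (E \in T).
    apply/eqP/idP => [/esym/(coset_idr NE) // | /coset_id//].
  by case: (E \in T); rewrite ?subr0 ?subrr.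
have -> : E \in T = false by apply: contraFF EN; exact: (subsetP sTN).
by rewrite subrr add0r mulr1.
Qed.

End Detection.

Theorem corollary3 (R : realFieldType) (n k : nat)
    (S L : {group pauli n}) (G : {group ptilde n}) (p pDD : R)
    (k_bounds : (1 <= k <= n)%N)
    (card_S : #|S| = (2 ^ (n - k))%N)
    (S_negI : negId n \notin S)
    (L_cent : L \subset 'C(S)%g)
    (cent_SL : 'C(S)%g = (S * L)%g)
    (SL_disjoint : (S / <[iId n]>)%g :&: (L / <[iId n]>)%g = 1%g)
    (G_nontrivial : G :!=: 1%g)
    (p_bounds : 0 <= p < 1)
    (pDD_bounds : 0 <= pDD <= 1) :
  let z := p / (3%:R - 3%:R * p) in
  let T := (S / <[iId n]>)%g in
  let N := ((S * L) / <[iId n]>)%g in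
  let U := unsuppressed G in
  let V := suppressed G in
  PA_LDD T N V p pDD = 1 /\
  1 - F_LDD T N V p pDD =
    (W (U :\: T) z + pDD * W (V :\: T) z
     - 4%:R ^- k * (W (U :\: N) z + pDD * W (V :\: N) z))
    / (W U z + pDD * W V z).
Proof.
move=> z T N U V.
have [p0 p1] := andP p_bounds; have [d0 _] := andP pDD_bounds.
have [_ kn] := andP k_bounds.
have z0 : 0 <= z.
  by rewrite divr_ge0 // subr_ge0 -{2}[3%:R]mulr1 ler_wpM2l // ltW.
have U1 : 1%g \in U.
  rewrite inE; apply/forall_inP => F _.
  rewrite -(morph1 (coset_morphism <[iId n]>%g)) /=; case: (cosetP F) => x _ ->.
  by rewrite pcommute_ppi mulg1 mul1g.
have D0 : W U z + pDD * W V z != 0 by rewrite gt_eqF // sum_tilt_gt0.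
have prob1 : \sum_E err_prob V p pDD E = 1.
  rewrite (eq_bigr _ (fun E _ => err_probE U pDD E p1)) -mulr_suml.
  by rewrite divff // sum_tiltT.
rewrite /N -cent_SL; split.
  rewrite /PA_LDD /LDD_law exchange_big -[RHS]prob1; apply: eq_bigr => E _.
  by rewrite -mulr_sumr sum_LDD_outcome mulr1.
have sTN : T \subset ('C(S) / <[iId n]>)%g.
  by rewrite quotientS //; exact: stabilizer_abelian.
(* Writing 1 as the total probability makes the infidelity a single sum over errors. *)
rewrite -[X in X - _]prob1 /F_LDD /LDD_law -sumrB.
rewrite -!sum_tilt -sum_tiltT mulr_sumr -(natrX R 4 k).
rewrite -(card_logical_classes kn card_S S_negI).
(* The sums off [T] and off [N] become sums over all errors, so both sides can be compared term by
   term. *)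
rewrite [X in (X - _) / _]big_mkcond [X in (_ - X) / _]big_mkcond -sumrB mulr_suml.
apply: eq_bigr => E _.
rewrite LDD_outcome1 // err_probE // !inE.
by case: (E \in T); case: (E \in _); rewrite /=; ring.
Qed.
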